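(* Let $\Lambda=\mathbb{Z}[t,t^{-1}]$ and let $M$ be a finitely generated $\Lambda$-module. Then: (1) There exist finitely generated abelian groups $U, B$ and injective homomorphisms $f,g:U\to B$ such that $M$ is isomorphic, as a $\Lambda$-module, to the infinite amalgamated free product $$\cdots\oplus_U B\oplus_U B\oplus_U\cdots$$ with identical amalgamations given by $f$ and $g$ (on which $t$ acts by the shift automorphism $\mu$). (2) For any such $U, B, f, g$ as in (1), if $U$ is generated by $q$ elements, then $\deg \Delta(M)\le q$.
   Context: $\Lambda=\mathbb{Z}[t,t^{-1}]$ is the ring of integer Laurent polynomials, a Noetherian unique factorization domain with units $\pm t^i$. Order: a finitely generated $\Lambda$-module $M$ is the cokernel of a homomorphism $\Lambda^r\xrightarrow{A}\Lambda^s$, where $A$ is an $r\times s$ presentation matrix over $\Lambda$ (columns correspond to generators, rows to relations), and one may assume $r\ge s$. The order $\Delta(M)$ is the greatest common divisor of the $s\times s$ minors of $A$. It is well defined up to multiplication by units $\pm t^i$. The degree $\deg\Delta$ of a nonzero Laurent polynomial is the difference between its highest and lowest exponents of $t$ with nonzero coefficient; the degree of $0$ is taken to be $-\infty$, so that the inequality is vacuous when $\Delta(M)=0$. Infinite amalgamated free product (in the category of abelian groups): given abelian groups $U,B$ and homomorphisms $f,g:U\to B$, let $B_j$ ($j\in\mathbb{Z}$) be copies of $B$. The group $\cdots\oplus_U B\oplus_U B\oplus_U\cdots$ is the quotient of $\bigoplus_{j\in\mathbb{Z}}B_j$ by the subgroup generated by all elements $f(u)_j-g(u)_{j+1}$ with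 $u\in U$, $j\in\mathbb{Z}$, where $b_j$ denotes the copy of $b\in B$ in $B_j$. The automorphism $\mu$ induced by $b_j\mapsto b_{j+1}$ (shift one place to the right) makes this group a $\Lambda$-module with $t$ acting as $\mu$; thus $t\,g(u)=f(u)$ holds for the copies of $f(u),g(u)$ in a fixed factor. *)

(* Defs.v *)
From HB Require Import structures.
From mathcomp Require Import all_boot all_order all_algebra.
From mathcomp Require Import finmap.
From mathcomp.multinomials Require Import monalg.
From mathcomp Require Import boolp constructive_ereal.

Set Implicit Arguments.
Unset Strict Implicit.
Unset Printing Implicit Defensive.

Import GRing.Theory.
Local Open Scope fset_scope.
Local Open Scope ring_scope.

(* For a zmodType V, {malg V[int]} is the group of finitely supported families
   int -> V, i.e. the direct sum of copies V_j of V indexed by j : int, and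
   << v *g j >> is the copy of v in V_j.  For V = int it is the additive group
   of Laurent polynomials, << a *g j >> being the monomial a t^j. *)
Section Conv.
Variable V : zmodType.
Implicit Types (p q : {malg int[int]}) (x y : {malg V[int]}).

(* For V = int this is the product of Laurent polynomials; in general it is the
   action of Z[t, t^-1] on the direct sum in which t v_j = v_(j+1). *)
Definition conv p x : {malg V[int]} :=
  \sum_(i <- msupp p) \sum_(j <- msupp x) << x@_j *~ p@_i *g i + j >>.

Lemma convw (d1 d2 : {fset int}) p x : msupp p `<=` d1 -> msupp x `<=` d2 ->
  conv p x = \sum_(i <- d1) \sum_(j <- d2) << x@_j *~ p@_i *g i + j >>.
Proof.
move=> le1 le2; rewrite /conv (big_fset_incl _ le1) /=.
  apply/eq_bigr=> i _; apply/big_fset_incl => // j _ /mcoeff_outdom ->.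
  by rewrite mul0rz monalgU0.
move=> i _ /mcoeff_outdom pi0.
by rewrite big1 // => j _; rewrite pi0 mulr0z monalgU0.
Qed.

Lemma convDl x : {morph conv^~ x : p q / p + q}.
Proof.
move=> p q; rewrite (convw (msuppD_le p q) (fsubset_refl _)).
rewrite (convw (fsubsetUl (msupp p) (msupp q)) (fsubset_refl _)).
rewrite (convw (fsubsetUr (msupp p) (msupp q)) (fsubset_refl _)).
rewrite -big_split /=; apply/eq_bigr=> i _.
rewrite -big_split /=; apply/eq_bigr=> j _.
by rewrite mcoeffD mulrzDr monalgUD.
Qed.

Lemma convDr p : {morph conv p : x y / x + y}.
Proof.
move=> x y; rewrite (convw (fsubset_refl _) (msuppD_le x y)).
rewrite (convw (fsubset_refl _) (fsubsetUl (msupp x) (msupp y))).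
rewrite (convw (fsubset_refl _) (fsubsetUr (msupp x) (msupp y))).
rewrite -big_split /=; apply/eq_bigr=> i _.
rewrite -big_split /=; apply/eq_bigr=> j _.
by rewrite mcoeffD mulrzDl monalgUD.
Qed.

Lemma conv0l x : conv 0 x = 0.
Proof. by apply: (addrI (conv 0 x)); rewrite -convDl !addr0. Qed.

Lemma conv0r p : conv p 0 = 0.
Proof. by apply: (addrI (conv p 0)); rewrite -convDr !addr0. Qed.

Lemma conv_suml (I : Type) (r : seq I) (F : I -> {malg int[int]}) x :
  conv (\sum_(i <- r) F i) x = \sum_(i <- r) conv (F i) x.
Proof. exact: (big_morph _ (convDl x) (conv0l x)). Qed.

Lemma conv_sumr p (I : Type) (r : seq I) (F : I -> {malg V[int]}) :
  conv p (\sum_(i <- r) F i) = \sum_(i <- r) conv p (F i).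
Proof. exact: (big_morph _ (convDr p) (conv0r p)). Qed.

Lemma convUU a v i j : conv << a *g i >> << v *g j >> = << v *~ a *g i + j >>.
Proof. by rewrite (convw msuppU_le msuppU_le) !big_seq_fset1 !mcoeffUU. Qed.

Lemma conv1 : left_id << 1 *g 0 >> conv.
Proof.
move=> x; rewrite [x]monalgE conv_sumr; apply: eq_bigr => j _.
by rewrite convUU add0r mulr1z.
Qed.

End Conv.

Lemma convC : commutative (@conv int).
Proof.
move=> p q; rewrite /conv exchange_big /=; apply: eq_bigr => j _.
by apply: eq_bigr => i _; rewrite addrC !mulrzz mulrC.
Qed.

Lemma convA (V : zmodType) p q (x : {malg V[int]}) :
  conv p (conv q x) = conv (conv p q) x.
Proof.
rewrite [x]monalgE !conv_sumr; apply: eq_bigr => k _.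
rewrite [q]monalgE conv_suml !conv_sumr conv_suml.
apply: eq_bigr => j _.
rewrite [p]monalgE !conv_suml; apply: eq_bigr => i _.
by rewrite !convUU addrA mulrzz mulrzA.
Qed.

Lemma conv1_neq0 : << 1 *g 0 >> != 0 :> {malg int[int]}.
Proof. by rewrite monalgU_eq0. Qed.

Definition laurent : Type := {malg int[int]}.

HB.instance Definition _ := GRing.Zmodule.on laurent.
HB.instance Definition _ := GRing.Zmodule_isComNzRing.Build laurent
  (@convA int) convC (@conv1 int) (fun p q x => convDl x p q) conv1_neq0.

Definition laurent_t : laurent := << 1 *g 1 >>.

Section Laurent.
Implicit Types p d : laurent.

(* The degree of a Laurent polynomial, -oo for the zero polynomial.  The head of
   the support only serves as a starting value for max and min. *)
Definition top_exp p : int :=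
  \big[Num.max/head 0 (msupp p)]_(i <- msupp p) i.
Definition bot_exp p : int :=
  \big[Num.min/head 0 (msupp p)]_(i <- msupp p) i.
Definition ldeg p : \bar int :=
  if p == 0 then -oo%E else (top_exp p - bot_exp p)%:E.

Definition ldvd d p : Prop := exists c, p = c * d.

Definition is_gcd (S : laurent -> Prop) d : Prop :=
  (forall p, S p -> ldvd d p) /\
  (forall c, (forall p, S p -> ldvd c p) -> ldvd c d).

End Laurent.

Definition fg_module (R : nzRingType) (M : lmodType R) : Prop :=
  exists (n : nat) (e : 'I_n -> M),
    forall x, exists c : 'I_n -> R, x = \sum_i c i *: e i.

Definition lmod_iso (R : nzRingType) (M N : lmodType R) : Prop :=
  exists phi : {linear M -> N}, bijective phi.

(* Exactness of R^r --A--> R^s --> M --> 0; elements of R^r and R^s are row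
   vectors, so the rows of A are the relations. *)
Definition presents (R : nzRingType) (r s : nat) (A : 'M[R]_(r, s))
    (M : lmodType R) : Prop :=
  exists pi : {linear 'rV[R]_s -> M},
    (forall m, exists x, pi x = m) /\
    (forall x, pi x = 0 <-> exists y, x = y *m A).

Definition max_minor (R : comNzRingType) (r s : nat) (A : 'M[R]_(r, s)) (p : R) :
    Prop :=
  exists h : 'I_s -> 'I_r,
    {homo h : i j / (i < j)%N} /\ p = \det (rowsub h A).

(* An order is only defined up to units, hence a relation. *)
Definition is_order (M : lmodType laurent) (Delta : laurent) : Prop :=
  exists (r s : nat) (A : 'M[laurent]_(r, s)),
    [/\ (s <= r)%N, presents A M & is_gcd (max_minor A) Delta].

Definition generated_by (V : zmodType) (q : nat) : Prop :=
  exists e : 'I_q -> V,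
    forall x, exists c : 'I_q -> int, x = \sum_i e i *~ c i.

Definition fg_group (V : zmodType) : Prop := exists q, generated_by V q.

Section GenSubgroup.
Variables (V : zmodType) (G : V -> Prop).

Definition gen_subgroup : {pred V} := fun x =>
  `[< forall S : {pred V}, zmod_closed S -> (forall y, G y -> y \in S) ->
      x \in S >].

Lemma gen_subgroupP x : reflect (forall S : {pred V}, zmod_closed S ->
  (forall y, G y -> y \in S) -> x \in S) (x \in gen_subgroup).
Proof. exact: asboolP. Qed.

Lemma mem_gen_subgroup x : G x -> x \in gen_subgroup.
Proof. by move=> Gx; apply/gen_subgroupP => S _; apply. Qed.

Lemma gen_subgroup_zmod_closed : zmod_closed gen_subgroup.
Proof.
split=> [|x y /gen_subgroupP Hx /gen_subgroupP Hy].
  by apply/gen_subgroupP => S [].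
by apply/gen_subgroupP => S cS GS; apply: (cS.2); [apply: Hx | apply: Hy].
Qed.

HB.instance Definition _ :=
  GRing.isZmodClosed.Build V gen_subgroup gen_subgroup_zmod_closed.

End GenSubgroup.

(* The direct sum of the B_j, as a module over Z[t, t^-1]. *)
Definition zsum (B : zmodType) : Type := {malg B[int]}.

Section DirectSum.
Variable B : zmodType.

HB.instance Definition _ := GRing.Zmodule.on (zsum B).

Fact zsum_scaleDl (x : zsum B) :
  {morph (fun p : laurent => conv p x : zsum B) : p q / p + q}.
Proof. exact: convDl. Qed.

HB.instance Definition _ := GRing.Zmodule_isLmodule.Build laurent (zsum B)
  (@convA B) (@conv1 B) (@convDr B) zsum_scaleDl.

Definition copy (j : int) (b : B) : zsum B := << b *g j >>.

Lemma zsum_tE j b : laurent_t *: copy j b = copy (j + 1) b.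
Proof. by rewrite [LHS]convUU mulr1z addrC. Qed.

End DirectSum.

Section Amalgam.
Variables (U B : zmodType) (f g : {additive U -> B}).

Definition amalgam_rel (x : zsum B) : Prop :=
  exists u j, x = copy j (f u) - copy (j + 1) (g u).

Definition amalgam_sub : {pred zsum B} := gen_subgroup amalgam_rel.

HB.instance Definition _ := GRing.ZmodClosed.on amalgam_sub.

Lemma amalgam_subZ (p : laurent) x : x \in amalgam_sub -> p *: x \in amalgam_sub.
Proof.
move=> /gen_subgroupP Hx.
apply: (Hx [pred x | p *: x \in amalgam_sub]) => [|_ [u [j ->]]].
  split=> [|y z]; rewrite !inE ?scaler0 ?rpred0 // => Sy Sz.
  by rewrite scalerBr rpredB.
rewrite inE [X in X *: _](monalgE p) scaler_suml rpred_sum // => i _.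
set a := p@_i; have -> : (<< a *g i >> : laurent) *: (copy j (f u) - copy (j + 1) (g u)) =
  copy (i + j) (f (u *~ a)) - copy (i + j + 1) (g (u *~ a)).
  by rewrite scalerBr; congr (_ - _); rewrite [LHS]convUU raddfMz ?addrA.
by apply: mem_gen_subgroup; exists (u *~ a), (i + j).
Qed.

Definition amalgam : Type := Quotient.quot amalgam_sub.

HB.instance Definition _ := GRing.Zmodule.on amalgam.
HB.instance Definition _ := EqQuotient.on amalgam.

Definition amalgam_pi (x : zsum B) : amalgam := \pi_(amalgam)%qT x.

Lemma amalgam_piD : {morph amalgam_pi : x y / x + y}.
Proof. exact: (raddfD (\pi_(Quotient.quot amalgam_sub)%qT)). Qed.

Lemma amalgam_piE x y : amalgam_pi x = amalgam_pi y <-> x - y \in amalgam_sub.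
Proof. by rewrite Quotient.idealrBE; split=> /eqP. Qed.

Lemma amalgam_reprK x : amalgam_pi (repr x) = x.
Proof. exact: reprK. Qed.

Definition amalgam_scale (p : laurent) (x : amalgam) : amalgam :=
  amalgam_pi (p *: repr x).

Lemma amalgam_scaleE p x : amalgam_scale p (amalgam_pi x) = amalgam_pi (p *: x).
Proof.
apply/amalgam_piE; rewrite -scalerBr; apply: amalgam_subZ.
by apply/amalgam_piE; rewrite amalgam_reprK.
Qed.

Fact amalgam_scaleA p q x :
  amalgam_scale p (amalgam_scale q x) = amalgam_scale (p * q) x.
Proof. by rewrite amalgam_scaleE scalerA. Qed.

Fact amalgam_scale1 : left_id 1 amalgam_scale.
Proof. by move=> x; rewrite /amalgam_scale scale1r amalgam_reprK. Qed.

Fact amalgam_scaleDr : right_distributive amalgam_scale +%R.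
Proof.
move=> p x y; rewrite -[x]amalgam_reprK -[y]amalgam_reprK -amalgam_piD.
by rewrite !amalgam_scaleE scalerDr amalgam_piD.
Qed.

Fact amalgam_scaleDl x : {morph amalgam_scale^~ x : p q / p + q}.
Proof. by move=> p q; rewrite /amalgam_scale scalerDl amalgam_piD. Qed.

HB.instance Definition _ := GRing.Zmodule_isLmodule.Build laurent amalgam
  amalgam_scaleA amalgam_scale1 amalgam_scaleDr amalgam_scaleDl.

(* The image of b_j in the amalgam. *)
Definition factor (j : int) (b : B) : amalgam := amalgam_pi (copy j b).

Lemma amalgam_glue j u : factor j (f u) = factor (j + 1) (g u).
Proof. by apply/amalgam_piE; apply: mem_gen_subgroup; exists u, j. Qed.

(* t acts as the shift automorphism. *)
Lemma amalgam_tE j b : laurent_t *: factor j b = factor (j + 1) b.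
Proof. by rewrite [LHS]amalgam_scaleE zsum_tE. Qed.

Lemma amalgam_t_glue j u : laurent_t *: factor j (g u) = factor j (f u).
Proof. by rewrite amalgam_tE amalgam_glue. Qed.

End Amalgam.

Definition amalgam_decomp (M : lmodType laurent) (U B : zmodType)
    (f g : {additive U -> B}) : Prop :=
  [/\ fg_group U, fg_group B, injective f, injective g
    & lmod_iso M (amalgam f g)].

(* Main.v *)
Require Import Defs.
From HB Require Import structures.
From mathcomp Require Import all_boot all_order perm all_algebra.
From mathcomp Require Import finmap.
From mathcomp.multinomials Require Import monalg.
From mathcomp Require Import boolp constructive_ereal.
From mathcomp Require Import zify.

(** Splitting.  Let [e_1, ..., e_n] generate [M].  The relations between them
    form a submodule [N] of [Z[t, t^-1]^n], and the argument of Hilbert's basis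
    theorem, with the ascending chain condition for subgroups of [Z^n], gives a
    [K] such that [N] is generated by its polynomial elements of degree at most
    [K] ([lspan_bounded]).  Let [B] be the group of the values in [M] of the
    combinations of the [t^j e_i] with [0 <= j <= K], and [U] that of those with
    [0 <= j < K]; let [g] be the inclusion and [f] the multiplication by [t],
    both of which are injective.  Sending [b_j] to [t^j b] is a surjection of
    the amalgam onto [M].  It is injective: in the amalgam [t^j e_i], for
    [j <= K], is the element [t^j e_i] of the factor 0 ([to_amalgam_bounded]),
    so every relation of degree at most [K] between the [e_i] already holds in
    that factor, and these relations generate [N] ([ker_to_amalgam]).

    Degree.  The amalgam is generated, over [Z[t, t^-1]], by generators of the
    abelian group [B], with the integral relations of [B] and one relation
    [f(u) - t g(u)] for each of the [q] generators [u] of [U]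
    ([lspan_relations]).  A square matrix of such relations has either a
    repeated row or at most [q] rows that involve [t], each in degree at most
    one; so its determinant has exponents between 0 and [q]
    ([det_relations_within]).  By Fitting's lemma ([det_relations_invariant]),
    an ideal that contains the maximal determinants of relations for one finite
    family of generators of a module contains those for any other family.
    Applied to the multiples of the order, this shows that the order divides
    the determinants above, which bounds its degree if one of them is not zero;
    applied to the zero ideal, it shows that the order is zero if they all
    are. *)

Set Implicit Arguments.
Unset Strict Implicit.
Unset Printing Implicit Defensive.

Import Order.TTheory GRing.Theory Num.Theory.
Local Open Scope fset_scope.
Local Open Scope ring_scope.

(** * Maximal minors and Fitting's lemma *)

Section Fitting.
Variable R : comNzRingType.

Definition submodule (V : lmodType R) (S : V -> Prop) : Prop :=
  S 0 /\ forall a x y, S x -> S y -> S (a *: x + y).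

(** The intersection of the submodules containing [G], so that a property of
    submodules transfers to the span with no linear combination at hand. *)
Definition lspan (V : lmodType R) (G : V -> Prop) (x : V) : Prop :=
  forall S, submodule S -> (forall y, G y -> S y) -> S x.

Lemma lspan_submodule (V : lmodType R) (G : V -> Prop) : submodule (lspan G).
Proof.
split=> [S [] //|a x y Gx Gy S cS GS].
by apply: cS.2; [exact: Gx | exact: Gy].
Qed.

Lemma mem_lspan (V : lmodType R) (G : V -> Prop) x : G x -> lspan G x.
Proof. by move=> Gx S _; apply. Qed.

Lemma submodule_sum (V : lmodType R) (S : V -> Prop) (I : Type) (r : seq I)
    (P : pred I) (F : I -> V) :
  submodule S -> (forall i, P i -> S (F i)) -> S (\sum_(i <- r | P i) F i).
Proof.
move=> [S0 SD] SF; apply: (big_ind S) => // x y Sx Sy.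
by rewrite -[x]scale1r; apply: SD.
Qed.

Lemma submoduleZ (V : lmodType R) (S : V -> Prop) a x :
  submodule S -> S x -> S (a *: x).
Proof. by move=> [S0 SD] Sx; rewrite -[_ *: _]addr0; apply: SD. Qed.

(* Over the regular module [R^o], submodules are ideals. *)
Variable I : R^o -> Prop.
Hypothesis idI : submodule I.

Definition set_row m n (A : 'M[R]_(m, n)) i0 (x : 'rV_n) : 'M[R]_(m, n) :=
  \matrix_i (if i == i0 then x else row i A).

Lemma row_set_row m n (A : 'M[R]_(m, n)) i0 x i :
  row i (set_row A i0 x) = if i == i0 then x else row i A.
Proof. by rewrite rowK. Qed.

(** The determinant is linear in each row. *)
Lemma det_set_row_submodule n (A : 'M[R]_n) i0 :
  submodule (fun x => I (\det (set_row A i0 x))).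
Proof.
have rw B x : row' i0 (set_row B i0 x) = row' i0 B.
  apply/row_matrixP => k; rewrite !row_rowsub row_set_row.
  by rewrite eq_sym (negbTE (neq_lift _ _)).
have lin a x y : \det (set_row A i0 (a *: x + y)) =
    a * \det (set_row A i0 x) + 1 * \det (set_row A i0 y).
  apply: (determinant_multilinear (i0 := i0)); last 2 first.
  - by rewrite !rw.
  - by rewrite !rw.
  by rewrite !row_set_row eqxx scale1r.
split=> [|a x y Ix Iy]; last by rewrite lin mul1r; apply: idI.2.
(* Linearity at [0 = (-1) *: 0 + 0] shows that a zero row gives zero. *)
have := lin (-1) 0 0; rewrite scaleN1r oppr0 addr0 mulN1r mul1r addNr => ->.
exact: idI.1.
Qed.

(** The rows can be moved from [G] to its span one at a time, the determinant
    being linear in the row that moves. *)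
Lemma det_lspan_rows n (G : 'rV[R]_n -> Prop) :
    (forall C : 'M_n, (forall i, G (row i C)) -> I (\det C)) ->
  forall C : 'M_n, (forall i, lspan G (row i C)) -> I (\det C).
Proof.
move=> IG C GC.
suff H k : forall C : 'M_n, (forall i : 'I_n, if (i < k)%N then
    lspan G (row i C) else G (row i C)) -> I (\det C).
  by apply: (H n) => i; rewrite ltn_ord.
elim: k => [|k IHk] {GC}C GC; first by apply: IG => i; have := GC i.
have [lt_kn|le_nk] := ltnP k n; last first.
  apply: IHk => i; have := GC i.
  by rewrite ltnS (leq_trans (ltnW _) le_nk) // !(leq_trans _ le_nk).
pose i0 := Ordinal lt_kn.
have -> : C = set_row C i0 (row i0 C).
  by apply/row_matrixP => i; rewrite row_set_row; case: eqP => [->|].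
have := GC i0; rewrite ltnSn => /(_ (fun x => I (\det (set_row C i0 x)))).
apply; first exact: det_set_row_submodule.
move=> y Gy; apply: IHk => i; rewrite row_set_row.
have [->|ne_i] := eqVneq i i0; first by rewrite ltnn.
have := GC i; rewrite ltnS leq_eqVlt.
by have /negbTE-> : val i != k by [].
Qed.

(** A choice of rows that repeats one has determinant zero, and any other is a
    permutation of an increasing choice, which changes only the sign. *)
Lemma det_rowsub_minors r s (A : 'M[R]_(r, s)) :
    (forall p, max_minor A p -> I p) ->
  forall h : 'I_s -> 'I_r, I (\det (rowsub h A)).
Proof.
move=> IA h.
have [/injectiveP inj_h|/injectivePn[i [j ne_ij eq_h]]] :=
    boolP (injectiveb h); last first.
  rewrite (determinant_alternate ne_ij); first exact: idI.1.
  by move=> k; rewrite !mxE eq_h.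
(* The increasing rearrangement of [h] is [h \o p] for a permutation [p]. *)
pose S := sort (fun i j : 'I_r => i <= j)%N (codom h).
have szS : size S == s by rewrite size_sort size_map size_enum_ord.
have pS : perm_eq (Tuple szS) [tuple h i | i < s].
  by rewrite perm_sort; apply: perm_refl.
have /tuple_permP[p Ep] := pS.
have {}Ep i : h (p i) = tnth (Tuple szS) i.
  rewrite -[in RHS](_ : [tuple tnth [tuple h i | i < s] (p i) | i < s] =
    Tuple szS) ?tnth_mktuple //.
  exact/val_inj/esym.
have homo : {homo (fun i => h (p i)) : i j / (i < j)%N}.
  move=> i j lt_ij; rewrite !Ep ltn_neqAle; apply/andP; split.
    rewrite (inj_eq val_inj) -!Ep (inj_eq inj_h) (inj_eq perm_inj).
    by rewrite neq_ltn lt_ij.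
  rewrite !(tnth_nth (h i)) /=.
  apply: (sorted_leq_nth (leT := fun i j : 'I_r => (i <= j)%N)) (ltnW lt_ij).
  - by move=> ? ? ?; apply: leq_trans.
  - by move=> ?; apply: leqnn.
  - by apply: sort_sorted => ? ?; apply: leq_total.
  - by rewrite inE (eqP szS).
  - by rewrite inE (eqP szS).
have := IA _ (ex_intro _ _ (conj homo erefl)).
have -> : rowsub (fun i => h (p i)) A = perm_mx p *m rowsub h A.
  by rewrite -row_permE; apply/matrixP => i j; rewrite !mxE.
rewrite det_mulmx det_perm => /(submoduleZ ((-1) ^+ p) idI).
by rewrite /GRing.scale /= mulrA -exprD -signr_odd oddD addbb mul1r.
Qed.

Lemma det_rows_minors r s (A : 'M[R]_(r, s)) :
    (forall p, max_minor A p -> I p) ->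
  forall C : 'M_s, (forall i, exists y, row i C = y *m A) -> I (\det C).
Proof.
move=> IA C CA; apply: (@det_lspan_rows _ (fun x => exists k, x = row k A)).
  move=> {CA}C /fin_all_exists[h hE].
  rewrite (_ : C = rowsub h A); first exact: det_rowsub_minors.
  by apply/row_matrixP => i; rewrite row_rowsub.
move=> i; have [y ->] := CA i; rewrite mulmx_sum_row.
apply: (submodule_sum _ (lspan_submodule _)) => k _.
by apply: (submoduleZ _ (lspan_submodule _)); apply: mem_lspan; exists k.
Qed.

(** A weak form of Laplace expansion along the columns [c]: a column outside
    the image of [c] is expanded, until only the columns [c] remain. *)
Lemma det_column_minors N s (D : 'M[R]_N) (c : 'I_s -> 'I_N) :
    injective c -> (forall h : 'I_s -> 'I_N, I (\det (mxsub h c D))) ->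
  I (\det D).
Proof.
elim: N => [|N IHN] in D c * => inj_c ID.
  case: s c inj_c ID => [|s] c inj_c; last by case: (c ord0).
  by move/(_ id); rewrite !det_mx00.
(* If no column is left out, then [c] is a permutation of the columns. *)
have [onto|] := boolP [forall j, j \in codom c].
  have eqN : s = N.+1.
    rewrite -(card_ord s) -[RHS]card_ord -(card_codom inj_c).
    by apply: eq_card => j; rewrite (forallP onto).
  case: _ / (esym eqN) c inj_c ID {onto} => c inj_c /(_ id).
  have -> : mxsub id c D = (perm_mx (perm inj_c) *m D^T)^T.
    by rewrite -row_permE; apply/matrixP => i j; rewrite !mxE permE.
  rewrite det_tr det_mulmx det_perm det_tr.
  move/(submoduleZ ((-1) ^+ perm inj_c) idI).
  by rewrite /GRing.scale /= mulrA -exprD -signr_odd oddD addbb mul1r.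
move=> /forallPn[j0 j0c].
have /fin_all_exists[c' c'E] k : exists k' : 'I_N, c k = lift j0 k'.
  have : c k != j0 by apply: contraNneq j0c => <-; apply: codom_f.
  by rewrite eq_sym => /unlift_some[k' -> _]; exists k'.
have inj_c' : injective c' by move=> k l eqkl; apply: inj_c; rewrite !c'E eqkl.
rewrite (expand_det_col D j0); apply: (@submodule_sum R^o I) => // i _.
apply: submoduleZ => //; rewrite /cofactor.
apply: (submoduleZ (V := R^o)) => //; apply: (IHN _ c') => // h.
have := ID (lift i \o h); congr (I (\det _)).
by apply/matrixP => k l; rewrite !mxE c'E.
Qed.

(** Fitting's lemma, for maximal minors.  Let [P] and [Q] be matrices that write
    the generators of each family in terms of the other one.  The square matrix
    with block rows [1 - P Q, - P] and [C Q, C] is the product of the block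
    triangular matrices with rows [1, - P], [0, C] and [1, 0], [Q, 1], so that
    its determinant is that of [C].  On the other hand the rows of its first
    block column are relations of [pi], so the minors on these columns are in
    [I], and so is the determinant. *)
Lemma det_relations_invariant (N : lmodType R) s s'
    (pi : {linear 'rV[R]_s -> N}) (pi' : {linear 'rV[R]_s' -> N}) :
    (forall x, exists y, pi y = x) -> (forall x, exists y, pi' y = x) ->
    (forall C : 'M_s, (forall i, pi (row i C) = 0) -> I (\det C)) ->
  forall C : 'M_s', (forall i, pi' (row i C) = 0) -> I (\det C).
Proof.
move=> surj surj' IC C' C'0.
have /fin_all_exists[p pE] (i : 'I_s) : exists y, pi' y = pi (delta_mx 0 i).
  exact: surj'.
have /fin_all_exists[q qE] (i : 'I_s') : exists y, pi y = pi' (delta_mx 0 i).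
  exact: surj.
pose P := \matrix_i p i; pose Q := \matrix_i q i.
have PE x : pi' (x *m P) = pi x.
  rewrite [in RHS](row_sum_delta x) mulmx_sum_row !linear_sum.
  by apply: eq_bigr => i _; rewrite !linearZ rowK pE.
have QE x : pi (x *m Q) = pi' x.
  rewrite [in RHS](row_sum_delta x) mulmx_sum_row !linear_sum.
  by apply: eq_bigr => i _; rewrite !linearZ rowK qE.
pose D := block_mx (1%:M - P *m Q) (- P) (C' *m Q) C'.
have detD : \det D = \det C'.
  have -> : D = block_mx 1%:M (- P) 0 C' *m block_mx 1%:M 0 Q 1%:M.
    by rewrite mulmx_block !mul1mx !mul0mx !mulmx1 mulNmx !add0r.
  by rewrite det_mulmx det_ublock det_lblock !det1 !mul1r mulr1.
rewrite -detD; apply: (@det_column_minors _ s _ (lshift s')) => [|h].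
  exact: lshift_inj.
apply: IC => i.
have -> : row i (mxsub h (lshift s') D) = row (h i) (lsubmx D).
  by apply/rowP => j; rewrite !mxE.
rewrite /D block_mxEv; set B1 := row_mx _ _; set B2 := row_mx _ _.
case: (split_ordP (h i)) => k ->.
  have -> : row (lshift s' k) (lsubmx (col_mx B1 B2)) = row k (1%:M - P *m Q).
    by apply/rowP => j; rewrite 2!mxE col_mxEu row_mxEl [RHS]mxE.
  by rewrite linearB linearB /= row_mul QE -PE -row_mul mul1mx subrr.
have -> : row (rshift s k) (lsubmx (col_mx B1 B2)) = row k (C' *m Q).
  by apply/rowP => j; rewrite 2!mxE col_mxEd row_mxEl [RHS]mxE.
by rewrite row_mul QE.
Qed.
End Fitting.

(** * Laurent polynomials: supports and degrees of divisors *)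

Definition tpow (i : int) : laurent := << 1 *g i >>.

Definition within (p : laurent) (a b : int) : Prop :=
  forall i, p@_i != 0 -> a <= i <= b.

Lemma laurentM p q : (p : laurent) * q = conv p q. Proof. by []. Qed.

Lemma coef_conv (V : zmodType) (p : laurent) (x : {malg V[int]}) k :
  (conv p x)@_k = \sum_(i <- msupp p) x@_(k - i) *~ p@_i.
Proof.
rewrite /conv raddf_sum; apply: eq_bigr => i _ /=.
rewrite raddf_sum /=.
under eq_bigr => j _ do rewrite mcoeffU.
case: (msuppP x (k - i)) => [ki|ki]; last first.
  rewrite mul0rz big1_seq // => j /andP[_ jx]; case: eqP => // E.
  by case/negP: ki; rewrite -E addrAC subrr add0r.
rewrite (big_fsetD1 (k - i)) //= subrKC eqxx mulr1n big1_seq ?addr0 // => j.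
rewrite in_fsetD1 => /andP[_ /andP[ne_j _]]; case: eqP => // E.
by case/eqP: ne_j; rewrite -E addrAC subrr add0r.
Qed.

Lemma coefU_conv (V : zmodType) a i (x : {malg V[int]}) k :
  (conv << a *g i >> x)@_k = x@_(k - i) *~ a.
Proof.
rewrite coef_conv msuppU; case: eqP => [->|_].
  by rewrite big_seq_fset0 mulr0z.
by rewrite big_seq_fset1 mcoeffUU.
Qed.

Lemma tpowD i j : tpow (i + j) = tpow i * tpow j.
Proof. by rewrite laurentM convUU mulr1z. Qed.

Lemma tpow0 : tpow 0 = 1. Proof. by []. Qed.

Lemma intr_laurent (a : int) : a%:~R = << a *g 0 >> :> laurent.
Proof.
pose c (b : int) : laurent := << b *g 0 >>.
have cD : {morph c : x y / x + y} by move=> x y; apply: monalgUD.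
have c0 : c 0 = 0 by apply: monalgU0.
have cN x : c (- x) = - c x by apply: monalgUN.
have cn (n : nat) : n%:R = c n%:Z.
  by elim: n => [|n IHn]; rewrite ?c0 // -addn1 PoszD cD natrD IHn.
by case: a => n; rewrite ?NegzE ?mulrNz -/(c _) ?cN -cn -pmulrn.
Qed.

Lemma coef_tpowM i (p : laurent) k : (tpow i * p)@_k = p@_(k - i).
Proof. by rewrite laurentM coefU_conv mulr1z. Qed.

Lemma coef_intr (a : int) k : (a%:~R : laurent)@_k = a *+ (k == 0).
Proof. by rewrite intr_laurent mcoeffU eq_sym. Qed.

Lemma laurentE (p : laurent) (d : {fset int}) : msupp p `<=` d ->
  p = \sum_(i <- d) (p@_i)%:~R * tpow i.
Proof.
move=> le_pd; rewrite [LHS](monalgEw le_pd); apply: eq_bigr => i _.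
by rewrite intr_laurent laurentM convUU add0r mulrzz mul1r.
Qed.

(** The coefficient of a product at an exponent reached in a single way from
    the two supports; extreme exponents are reached in this way. *)
Lemma coefM_unique (p q : laurent) i j :
    (forall i' j', p@_i' != 0 -> q@_j' != 0 -> i' + j' = i + j -> i' = i) ->
  (p * q)@_(i + j) = p@_i * q@_j.
Proof.
move=> uniq_ij; rewrite laurentM coef_conv.
have zero i' : i' != i -> q@_(i + j - i') *~ p@_i' = 0.
  move=> ne_i; have [->|p_i'] := eqVneq p@_i' 0; first by rewrite mulr0z.
  have [->|q_j'] := eqVneq q@_(i + j - i') 0; first by rewrite mul0rz.
  by case/eqP: ne_i; apply: uniq_ij q_j' _ => //; rewrite subrKC.
case: (msuppP p i) => [ip|ip]; last first.
  rewrite mul0r big1_seq // => i' /andP[_ i'p]; apply: zero.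
  by apply: contraNneq ip => <-.
rewrite (big_fsetD1 i) //= big1_seq => [|i' /andP[_]]; last first.
  by rewrite in_fsetD1 => /andP[/zero].
by rewrite addr0 addrAC subrr add0r mulrzz mulrC.
Qed.

Lemma head_msupp (p : laurent) : p != 0 -> head 0 (msupp p) \in msupp p.
Proof.
case: (fset_0Vmem (msupp p)) => [E|[i ip _]].
  by rewrite [p]monalgE E big_seq_fset0 eqxx.
have {}ip : i \in enum_fset (msupp p) by [].
suff : head 0 (enum_fset (msupp p)) \in enum_fset (msupp p) by [].
by case: (enum_fset _) ip => // a s _; apply: mem_head.
Qed.

Lemma top_expP (p : laurent) : p != 0 ->
  p@_(top_exp p) != 0 /\ forall i, p@_i != 0 -> i <= top_exp p.
Proof.
move=> p0; split=> [|i]; rewrite mcoeff_neq0; last first.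
  by move=> ip; apply: (le_bigmax_seq _ _ _ id).
rewrite /top_exp big_seq.
apply: (big_ind (fun i => i \in msupp p)) => [|x y xp yp|//].
  exact: head_msupp.
by rewrite /Num.max; case: ifP.
Qed.

Lemma bot_expP (p : laurent) : p != 0 ->
  p@_(bot_exp p) != 0 /\ forall i, p@_i != 0 -> bot_exp p <= i.
Proof.
move=> p0; split=> [|i]; rewrite mcoeff_neq0; last first.
  by move=> ip; apply: (ge_bigmin_seq _ _ _ id).
rewrite /bot_exp big_seq.
apply: (big_ind (fun i => i \in msupp p)) => [|x y xp yp|//].
  exact: head_msupp.
by rewrite /Num.min; case: ifP.
Qed.

(** Top and bottom exponents of a product add up, because the integers have no
    zero divisors; hence a divisor is no wider than its nonzero multiples. *)
Lemma ldeg_dvd (d p : laurent) (a b : int) :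
  ldvd d p -> p != 0 -> within p a b -> (ldeg d <= (b - a)%:E)%E.
Proof.
move=> [c ->] cd0 wp.
have [c0 d0] : c != 0 /\ d != 0.
  by split; apply: contraNneq cd0 => ->; rewrite ?mul0r ?mulr0.
have [ct cle] := top_expP c0; have [dt dle] := top_expP d0.
have [cb cge] := bot_expP c0; have [db dge] := bot_expP d0.
rewrite /ldeg (negPf d0) lee_fin.
have /wp : (c * d)@_(top_exp c + top_exp d) != 0.
  rewrite coefM_unique ?mulf_neq0 // => i j /cle ? /dle ?; lia.
have /wp : (c * d)@_(bot_exp c + bot_exp d) != 0.
  rewrite coefM_unique ?mulf_neq0 // => i j /cge ? /dge ?; lia.
have := cle _ cb; lia.
Qed.

Lemma withinP (p : laurent) a b :
  within p a b <-> forall i, ~~ (a <= i <= b) -> p@_i = 0.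
Proof.
split=> wp i; first by apply: contraNeq => /wp.
by apply: contraNT => /wp ->.
Qed.

Lemma within0 a b : within 0 a b.
Proof. by move=> i; rewrite mcoeff0 eqxx. Qed.

Lemma withinD p q a b : within p a b -> within q a b -> within (p + q) a b.
Proof.
move=> /withinP wp /withinP wq; apply/withinP => i ni.
by rewrite mcoeffD wp ?wq ?addr0.
Qed.

Lemma withinM p q a b a' b' : within p a b -> within q a' b' ->
  within (p * q) (a + a') (b + b').
Proof.
move=> wp wq; apply/withinP => k nk.
rewrite laurentM coef_conv big1_seq // => i /andP[_].
rewrite -mcoeff_neq0 => /wp ?.
have [->|/wq ?] := eqVneq q@_(k - i) 0; first by rewrite mul0rz.
lia.
Qed.

(** * The amalgam by generators and relations, and the degree of the order *)

Section LinearCombinations.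
Variables (R : nzRingType) (V : lmodType R) (n : nat) (e : 'I_n -> V).

Definition lincomb (c : 'rV[R]_n) : V := \sum_i c 0 i *: e i.

Fact lincomb_is_linear : linear lincomb.
Proof.
move=> a c d; rewrite /lincomb scaler_sumr -big_split /=.
by apply: eq_bigr => i _; rewrite !mxE scalerDl scalerA.
Qed.
HB.instance Definition _ :=
  GRing.isLinear.Build R _ V *:%R lincomb lincomb_is_linear.

End LinearCombinations.

Definition zcomb (B : zmodType) n (b : 'I_n -> B) (v : 'rV[int]_n) : B :=
  \sum_i b i *~ v 0 i.

Lemma raddf_zcomb (B B' : zmodType) (h : {additive B -> B'}) n
    (b : 'I_n -> B) v :
  h (zcomb b v) = zcomb (h \o b) v.
Proof. by rewrite raddf_sum; apply: eq_bigr => i _; rewrite raddfMz. Qed.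

HB.instance Definition _ (B : zmodType) j :=
  GRing.isAdditive.Build B (zsum B) (copy j) (@monalgUB int B j).

Definition constv n (v : 'rV[int]_n) : 'rV[laurent]_n := map_mx intr v.

Definition coefv n (c : 'rV[laurent]_n) (j : int) : 'rV[int]_n :=
  \row_i (c 0 i)@_j.

Lemma rV_laurentE n (c : 'rV[laurent]_n) :
  exists d : seq int, c = \sum_(j <- d) tpow j *: constv (coefv c j).
Proof.
pose d := \bigcup_(i <- enum 'I_n) msupp (c 0 i).
exists d; apply/rowP => i; rewrite summxE.
have : msupp (c 0 i) `<=` d by apply: bigfcup_sup; rewrite ?mem_enum.
move=> /laurentE ->; apply: eq_bigr => j _.
by rewrite !mxE mulrC.
Qed.

Lemma coefv_constv n (v : 'rV[int]_n) j : coefv (constv v) j = v *+ (j == 0).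
Proof.
apply/rowP => i; rewrite !mxE; apply: etrans (coef_intr _ _) _.
by case: (j =P 0) => _; rewrite ?mulr1n ?mulr0n ?mxE.
Qed.

Lemma coef_convU (V : zmodType) (p : laurent) (b : V) k j :
  (conv p << b *g k >>)@_j = b *~ p@_(j - k).
Proof.
rewrite [p in LHS](monalgE) conv_suml raddf_sum /=.
under eq_bigr => i _ do rewrite convUU mcoeffU.
case: (msuppP p (j - k)) => [ip|ip]; last first.
  rewrite mulr0z big1_seq // => i /andP[_ i'p]; case: eqP => // E.
  by case/negP: ip; rewrite -E addrK.
rewrite (big_fsetD1 (j - k)) //= subrK eqxx mulr1n big1_seq ?addr0 // => i.
rewrite in_fsetD1 => /andP[_ /andP[ne_i _]]; case: eqP => // E.
by case/eqP: ne_i; rewrite -E addrK.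
Qed.

Lemma zsumE (B : zmodType) (x : zsum B) :
  x = \sum_(j <- msupp x) tpow j *: copy 0 (x@_j).
Proof.
rewrite [LHS]monalgE; apply: eq_bigr => j _.
by rewrite [RHS]convUU addr0 mulr1z.
Qed.

Section AmalgamPresentation.
Variables (U B : zmodType) (f g : {additive U -> B}).

Fact amalgam_pi_is_linear : linear (amalgam_pi f g).
Proof. by move=> p x y; rewrite amalgam_piD -amalgam_scaleE. Qed.
HB.instance Definition _ := GRing.isLinear.Build laurent (zsum B) (amalgam f g)
  *:%R (amalgam_pi f g) amalgam_pi_is_linear.

Variables (n : nat) (b : 'I_n -> B).
Hypothesis genB : forall x, exists v, x = zcomb b v.

Definition copies : 'rV[laurent]_n -> zsum B := lincomb (fun i => copy 0 (b i)).
HB.instance Definition _ := GRing.isLinear.Build laurent _ (zsum B) *:%R copies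
  (lincomb_is_linear _).

Lemma coef_copies c j : (copies c)@_j = zcomb b (coefv c j).
Proof.
rewrite /copies /lincomb raddf_sum; apply: eq_bigr => i _ /=.
by rewrite [LHS]coef_convU subr0 mxE.
Qed.

Lemma copies_constv v : copies (constv v) = copy 0 (zcomb b v).
Proof.
apply/malgP => j; rewrite coef_copies /copy mcoeffU.
rewrite coefv_constv eq_sym; case: eqP => _; first by rewrite !mulr1n.
by rewrite mulr0n /zcomb big1 // => i _; rewrite mxE mulr0z.
Qed.

Lemma copies_surj x : exists c, copies c = x.
Proof.
have /choice[v vE] : forall y, exists v, y = zcomb b v by [].
exists (\sum_(j <- msupp x) tpow j *: constv (v x@_j)).
rewrite linear_sum [RHS]zsumE; apply: eq_bigr => j _.
by rewrite linearZ /= copies_constv -vE.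
Qed.

Lemma pi_copies c :
  amalgam_pi f g (copies c) = lincomb (fun i => factor f g 0 (b i)) c.
Proof. by rewrite linear_sum; apply: eq_bigr => i _; rewrite linearZ. Qed.

Lemma factors_surj x : exists c, lincomb (fun i => factor f g 0 (b i)) c = x.
Proof.
rewrite -(amalgam_reprK x).
have [c <-] := copies_surj (generic_quotient.repr x).
by exists c; rewrite pi_copies.
Qed.

Variables (q : nat) (u : 'I_q -> U).
Hypothesis genU : forall x, exists v, x = zcomb u v.
Variables F G : 'I_q -> 'rV[int]_n.
Hypothesis FE : forall k, f (u k) = zcomb b (F k).
Hypothesis GE : forall k, g (u k) = zcomb b (G k).

Definition glue_row (k : 'I_q) : 'rV[laurent]_n :=
  constv (F k) - laurent_t *: constv (G k).

(** Defining relations of the amalgam on the generators [b] of one factor: the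
    integral relations of the group [B], and one relation for each generator of
    [U], in which [t] occurs to the first power. *)
Definition relation (c : 'rV[laurent]_n) : Prop :=
  (exists2 v, zcomb b v = 0 & c = constv v) \/ (exists k, c = glue_row k).

Lemma copies_glue k : copies (glue_row k) = copy 0 (f (u k)) - copy 1 (g (u k)).
Proof. by rewrite linearB linearZ /= !copies_constv -FE -GE zsum_tE add0r. Qed.

(** These relations suffice.  The images under [copies] of their combinations
    form a subgroup that contains the relators of the amalgam; and a row killed
    by [copies] has, at each power of [t], an integral relation of [B] as
    coefficient. *)
Lemma lspan_relations c :
  lincomb (fun i => factor f g 0 (b i)) c = 0 -> lspan relation c.
Proof.
pose S : {pred zsum B} := fun x =>
  `[< exists2 d, lspan relation d & copies d = x >].
have spS := lspan_submodule relation.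
have copies0 d : copies d = 0 -> lspan relation d.
  move=> d0; have [J ->] := rV_laurentE d; apply: (submodule_sum _ spS) => j _.
  apply: (submoduleZ _ spS); apply: mem_lspan; left; exists (coefv d j) => //.
  by rewrite -coef_copies d0 mcoeff0.
have S_zmod : zmod_closed S.
  split=> [|x y /asboolP[d sd <-] /asboolP[d' sd' <-]].
    by apply/asboolP; exists 0; rewrite ?linear0 //; case: spS.
  apply/asboolP; exists (d - d'); last by rewrite linearB.
  by rewrite addrC -scaleN1r; apply: spS.2.
rewrite -pi_copies -(linear0 (amalgam_pi f g)) => /amalgam_piE.
rewrite subr0 => /gen_subgroupP/(_ S S_zmod) H.
have /asboolP[d sd dE] : copies c \in S.
  apply: H => _ [w [j ->]].
  have [v ->] := genU w; apply/asboolP.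
  exists (tpow j *: \sum_k (v 0 k)%:~R *: glue_row k).
    apply: (submoduleZ _ spS); apply: (submodule_sum _ spS) => k _.
    by apply: (submoduleZ _ spS); apply: mem_lspan; right; exists k.
  rewrite linearZ linear_sum.
  under eq_bigr => k _ do rewrite linearZ /= copies_glue scaler_int mulrzBl.
  rewrite sumrB -[X in X - _]raddf_zcomb -[X in _ - X]raddf_zcomb.
  apply: etrans (scalerBr _ _ _) _; rewrite (raddf_zcomb f) (raddf_zcomb g).
  by congr (_ - _); rewrite [LHS]convUU mulr1z ?addr0.
rewrite -[c](subrK d) addrC -[d in d + _]scale1r; apply: spS.2 => //.
by apply: copies0; rewrite linearB /= dE subrr.
Qed.

End AmalgamPresentation.

Lemma within_prod (I : finType) (F : I -> laurent) (w : I -> nat) :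
  (forall i, within (F i) 0 (w i)) -> within (\prod_i F i) 0 (\sum_i w i)%N.
Proof.
move=> wF; rewrite (big_morph Posz PoszD erefl).
apply: (big_ind2 (fun p (k : int) => within p 0 k)) => [|p j p' j' wp wp'|//].
  move=> i; rewrite -tpow0 mcoeffU.
  by case: (0 =P i) => [<- //|_]; rewrite eqxx.
by rewrite -[0]add0r; apply: withinM.
Qed.

Lemma within_constv n (v : 'rV[int]_n) j : within (constv v 0 j) 0 0.
Proof.
by move=> i; rewrite mxE coef_intr; case: (i =P 0) => [-> //|_]; rewrite eqxx.
Qed.

(** A nonzero determinant uses each gluing row at most once, so at most [q] of
    its rows are not constant, and these have degree at most one in [t]. *)
Lemma det_relations_within (B : zmodType) n (b : 'I_n -> B) q
    (F G : 'I_q -> 'rV[int]_n) (C : 'M[laurent]_n) :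
  (forall i, relation b F G (row i C)) -> within (\det C) 0 q.
Proof.
move=> relC.
have /fin_all_exists[t tE] (i : 'I_n) : exists t : option 'I_q,
    if t is Some k then row i C = glue_row F G k
    else exists v, row i C = constv v.
  have [[v _ ->]|[k ->]] := relC i; first by exists None, v.
  by exists (Some k).
have [/existsP[i /existsP[j /and3P[ne_ij ti /eqP eq_t]]]|distinct] :=
    boolP [exists i, exists j, [&& i != j, t i & t i == t j]].
  rewrite (determinant_alternate ne_ij); first exact: within0.
  have := tE j; rewrite -eq_t; have := tE i; case: (t i) ti => // k _ Ei Ej l.
  have := congr1 (fun x : 'rV_n => x 0 l) (etrans Ei (esym Ej)).
  by rewrite !mxE.
(* The exponent bound contributed by row [i]. *)
pose w i : nat := isSome (t i).
have le_wq : (\sum_i w i <= q)%N.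
  have -> : \sum_i w i = #|[set i | t i]| :> nat.
    rewrite -sum1_card [RHS]big_mkcond /=; apply: eq_bigr => i _.
    by rewrite inE /w; case: (t i).
  have inj_t : {in [set i | t i] &, injective t}.
    move=> i j; rewrite !inE => ti tj eq_t; apply/eqP/negPn/negP => ne_ij.
    case/negP: distinct; apply/existsP; exists i; apply/existsP; exists j.
    by rewrite ne_ij ti eq_t eqxx.
  rewrite -(card_in_imset inj_t).
  apply: (@leq_trans #|[set~ None : option 'I_q]|).
    apply/subset_leq_card/subsetP => _ /imsetP[i ti ->].
    by move: ti; rewrite !inE; case: (t i).
  by rewrite cardsC1 card_option card_ord.
have wq p : within p 0 (\sum_i w i)%N -> within p 0 q.
  by move=> wp i /wp; lia.
apply: wq.
rewrite /determinant; apply: (big_ind (fun p => within p _ _)) => [|p p'|s _].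
- exact: within0.
- exact: withinD.
have wp : within (\prod_i C i (s i)) 0 (\sum_i w i)%N.
  apply: within_prod => i; rewrite /w; have := tE i.
  have EC : C i (s i) = row i C 0 (s i) by rewrite mxE.
  case: (t i) => [k rk|[v rv]]; rewrite {}EC ?rk ?rv; last exact: within_constv.
  rewrite mxE; apply: (@withinD _ _ 0 1) => [k' /within_constv|k'].
    by lia.
  rewrite mxE mxE mcoeffN oppr_eq0 coef_tpowM => /within_constv; lia.
by rewrite mulr_sign; case: (s : bool) => // i; rewrite mcoeffN oppr_eq0 => /wp.
Qed.

(** By Fitting's lemma the order divides the determinant of every square matrix
    of relations of the amalgam, whose degree is at most [q].  If all these
    determinants vanish, then, in the other direction, so do the minors of
    which the order is the greatest common divisor, and the order is zero. *)
Lemma order_ldeg_le (U B : zmodType) (f g : {additive U -> B})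
    (M : lmodType laurent) q Delta :
  fg_group B -> generated_by U q -> lmod_iso M (amalgam f g) ->
  is_order M Delta -> (ldeg Delta <= (q%:Z)%:E)%E.
Proof.
move=> [n [b genB]] [u genU] [phi [psi phiK psiK]].
move=> [r [s [A [_ [pi [pi_surj kerA]] gcdA]]]].
have {}genB x : exists v, x = zcomb b v.
  have [c ->] := genB x; exists (\row_i c i).
  by apply: eq_bigr => i _; rewrite mxE.
have {}genU x : exists v, x = zcomb u v.
  have [c ->] := genU x; exists (\row_i c i).
  by apply: eq_bigr => i _; rewrite mxE.
have /fin_all_exists[F FE] k : exists v, f (u k) = zcomb b v by [].
have /fin_all_exists[G GE] k : exists v, g (u k) = zcomb b v by [].
pose piA : {linear 'rV[laurent]_s -> amalgam f g} := phi \o pi.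
pose piB : {linear 'rV[laurent]_n -> amalgam f g} :=
  lincomb (fun i => factor f g 0 (b i)).
have piA_surj x : exists y, piA y = x.
  by have [y yE] := pi_surj (psi x); exists y; rewrite /= yE psiK.
have piB_surj x : exists y, piB y = x by apply: factors_surj.
have kerP x : piA x = 0 <-> exists y, x = y *m A.
  rewrite -kerA /=; split=> [|->]; last exact: linear0.
  by move/(congr1 psi); rewrite phiK -(linear0 phi) phiK.
have idD d : @submodule laurent laurent^o (ldvd d).
  split=> [|a x y [x' ->] [y' ->]]; first by exists 0; rewrite mul0r.
  by exists (a * x' + y'); rewrite mulrDl -mulrA.
have detB d : (forall C : 'M_n, (forall i, relation b F G (row i C)) ->
    ldvd d (\det C)) -> ldvd d Delta.
  move=> dC; apply: gcdA.2 => _ [h [_ ->]].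
  apply: (det_relations_invariant (idD d) piB_surj piA_surj) => [C C0|i].
    apply: (det_lspan_rows (idD d) dC) => i.
    exact: (lspan_relations genU FE GE (C0 i)).
  by apply/kerP; exists (delta_mx 0 (h i)); rewrite row_rowsub rowE.
have detA C : (forall i, relation b F G (row i C)) -> ldvd Delta (\det C).
  move=> relC; apply: (det_relations_invariant (idD Delta) piA_surj piB_surj).
    move=> {relC}C C0; apply: (det_rows_minors (idD Delta) gcdA.1) => i.
    by apply/kerP; apply: C0.
  move=> i; have [[v v0 ->]|[k ->]] := relC i; rewrite /= -pi_copies.
    by rewrite copies_constv v0 raddf0; apply: linear0.
  have -> : copies b (glue_row F G k) = copy 0 (f (u k)) - copy 1 (g (u k)).
    exact: (copies_glue FE GE).
  rewrite linearB; apply/eqP; rewrite subr_eq0; apply/eqP.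
  exact: (amalgam_glue f g 0).
have [all0|] := pselect
    (forall C : 'M_n, (forall i, relation b F G (row i C)) -> \det C = 0).
  have [|c ->] := detB 0; last by rewrite mulr0 /ldeg eqxx leNye.
  by move=> C relC; exists 0; rewrite mulr0 all0.
move=> /existsNP[C /not_implyP[relC /eqP det0]].
rewrite -[q%:Z]subr0; apply: ldeg_dvd (detA C relC) det0 _.
exact: det_relations_within relC.
Qed.

(** * Noetherianity: chains of subgroups and relations of bounded degree *)

Definition zsubgroup (V : zmodType) (C : V -> Prop) : Prop :=
  C 0 /\ forall x y, C x -> C y -> C (x - y).

Lemma zsubgroupD (V : zmodType) (C : V -> Prop) x y :
  zsubgroup C -> C x -> C y -> C (x + y).
Proof.
move=> [C0 CB] Cx Cy; rewrite -[y]opprK -[- y]sub0r.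
by apply: (CB) => //; apply: CB.
Qed.

Lemma zsubgroupMz (V : zmodType) (C : V -> Prop) x (a : int) :
  zsubgroup C -> C x -> C (x *~ a).
Proof.
move=> sC Cx.
have Cn (k : nat) : C (x *+ k).
  by elim: k => [|k IHk]; [exact: sC.1 | rewrite mulrS; apply: zsubgroupD].
case: a => k; first exact: Cn.
by rewrite NegzE mulrNz -pmulrn -sub0r; apply: sC.2; [exact: sC.1 | exact: Cn].
Qed.

Definition noetherian_group (V : zmodType) : Prop :=
  forall C : nat -> V -> Prop, (forall k, zsubgroup (C k)) ->
    (forall k x, C k x -> C k.+1 x) ->
  exists K, forall k x, C k x -> C K x.

Lemma chain_le (V : zmodType) (C : nat -> V -> Prop) k l x :
  (forall k x, C k x -> C k.+1 x) -> (k <= l)%N -> C k x -> C l x.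
Proof.
move=> incC; elim: l => [|l IHl]; first by rewrite leqn0 => /eqP->.
by rewrite leq_eqVlt => /predU1P[->//|/IHl]; move=> H /H /incC.
Qed.

(** The least positive element of the union of a chain already lies in some
    term, and generates the union. *)
Lemma noetherian_int : noetherian_group int.
Proof.
move=> C sC incC.
have [[k0 [x0 [x0_neq0 Cx0]]]|noC] :=
    pselect (exists k x, x != 0 /\ C k x); last first.
  exists 0%N => k x Cx; have [->|x_neq0] := eqVneq x 0; first exact: (sC _).1.
  by case: noC; exists k, x.
pose P m := `[< exists k, C k m.+1%:Z >].
have exP : exists m, P m.
  exists `|x0|.-1%N; apply/asboolP; exists k0; rewrite prednK ?absz_gt0 //.
  case: (lerP 0 x0) => x0_sign; first by rewrite gez0_abs.
  by rewrite ltz0_abs // -sub0r; apply: (sC _).2 => //; exact: (sC _).1.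
case: (ex_minnP exP) => m /asboolP[K CKd] min_m; exists K => k x Ckx.
pose d : int := m.+1%:Z; rewrite (divz_eq x d).
have -> : (x %% d)%Z = 0.
  have r_ge0 : 0 <= (x %% d)%Z by apply: modz_ge0.
  have r_lt : (x %% d)%Z < d by apply: ltz_pmod.
  case E : (x %% d)%Z r_ge0 r_lt => [[|r]|r] // _ r_lt.
  suff /min_m : P r by move: r_lt; rewrite /d; lia.
  apply/asboolP; exists (maxn k K); rewrite -E.
  have -> : (x %% d)%Z = x - (x %/ d)%Z * d.
    by rewrite {2}(divz_eq x d) addrC addKr.
  apply: (sC _).2; first by apply: chain_le Ckx => //; apply: leq_maxl.
  rewrite mulrC -mulrzz; apply: zsubgroupMz => //.
  by apply: chain_le CKd => //; apply: leq_maxr.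
by rewrite addr0 mulrC -mulrzz; apply: zsubgroupMz.
Qed.

(** A subgroup of an extension is determined, among those that contain it, by
    its trace on the kernel and its image in the quotient. *)
Lemma noetherian_extension (V' V W : zmodType) (i : {additive V' -> V})
    (h : {additive V -> W}) :
    (forall x, h x = 0 -> exists y, i y = x) ->
  noetherian_group V' -> noetherian_group W -> noetherian_group V.
Proof.
move=> exact_ih accV' accW C sC incC.
have [||K1 CK1] := accV' (fun k y => C k (i y)).
- move=> k; split=> [|x y]; first by rewrite raddf0; apply: (sC _).1.
  by rewrite raddfB; apply: (sC _).2.
- by move=> k y; apply: incC.
have [||K2 CK2] := accW (fun k w => exists2 x, C k x & h x = w).
- move=> k; split=> [|_ _ [x Cx <-] [y Cy <-]].
    by exists 0; rewrite ?raddf0 //; apply: (sC _).1.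
  by exists (x - y); rewrite ?raddfB //; apply: (sC _).2.
- by move=> k _ [x Cx <-]; exists x => //; apply: incC.
exists (maxn K1 K2) => k x Cx.
have [x2 Cx2 hx2] := CK2 k (h x) (ex_intro2 _ _ x Cx erefl).
have [|y iy] := exact_ih (x - x2); first by rewrite raddfB hx2 subrr.
rewrite -(subrK x2 x); apply: zsubgroupD => //; last first.
  by apply: chain_le Cx2 => //; apply: leq_maxr.
apply: (@chain_le _ _ K1) => //; first exact: leq_maxl.
rewrite -iy; apply: (CK1 (maxn k K2)); rewrite iy; apply: (sC _).2.
  by apply: chain_le Cx => //; apply: leq_maxl.
by apply: chain_le Cx2 => //; apply: leq_maxr.
Qed.

Lemma noetherian_rV n : noetherian_group 'rV[int]_n.
Proof.
elim: n => [|n IHn].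
  by move=> C sC _; exists 0%N => k x _; rewrite (thinmx0 x); apply: (sC _).1.
(* [Z^(n+1)] is an extension of [Z], the first coordinate, by [Z^n]. *)
pose i (y : 'rV[int]_n) : 'rV[int]_(1 + n) := row_mx 0 y.
pose h (x : 'rV[int]_(1 + n)) : int := x 0 0.
have i_add : additive i by move=> x y; rewrite /i opp_row_mx add_row_mx subrr.
have h_add : additive h by move=> x y; rewrite /h !mxE.
pose iA := GRing.isAdditive.Build _ _ i i_add.
pose hA := GRing.isAdditive.Build _ _ h h_add.
pose i' : {additive _ -> _} := HB.pack i iA.
pose h' : {additive _ -> _} := HB.pack h hA.
apply: (@noetherian_extension _ _ _ i' h' _ IHn noetherian_int) => x hx.
exists (rsubmx (x : 'rV_(1 + n))); rewrite /= /i -[RHS]hsubmxK.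
congr row_mx; apply/rowP => j; rewrite ord1 !mxE.
by rewrite -[LHS]hx /h; congr (x _ _); apply: val_inj.
Qed.

Section Bounded.
Variable n : nat.
Implicit Types x y : 'rV[laurent]_n.

Definition bounded (m : nat) x : Prop :=
  forall j, coefv x j != 0 -> 0 <= j < m%:Z.

Lemma coefvD x y j : coefv (x + y) j = coefv x j + coefv y j.
Proof. by apply/rowP => i; rewrite !mxE mcoeffD. Qed.

Lemma coefvB x y j : coefv (x - y) j = coefv x j - coefv y j.
Proof. by apply/rowP => i; rewrite !mxE mcoeffB. Qed.

Lemma coefv0 j : coefv (0 : 'rV[laurent]_n) j = 0.
Proof. by apply/rowP => i; rewrite !mxE mcoeff0. Qed.

Lemma coefv_tpow a x j : coefv (tpow a *: x) j = coefv x (j - a).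
Proof. by apply/rowP => i; rewrite !mxE coef_tpowM. Qed.

Lemma coefv_inj x y : (forall j, coefv x j = coefv y j) -> x = y.
Proof.
move=> eqxy; apply/rowP => i; apply/malgP => j.
by have := congr1 (fun v : 'rV_n => v 0 i) (eqxy j); rewrite !mxE.
Qed.

Lemma boundedP m x :
  bounded m x <-> forall j, ~~ (0 <= j < m%:Z) -> coefv x j = 0.
Proof.
split=> bx j; first by apply: contraNeq => /bx.
by apply: contraNT => /bx ->.
Qed.

Lemma bounded_zsubgroup m : zsubgroup (bounded m).
Proof.
split=> [|x y /boundedP bx /boundedP b_y]; apply/boundedP => j nj.
  exact: coefv0.
by rewrite coefvB bx ?b_y ?subrr.
Qed.

Lemma boundedW m m' x : (m <= m')%N -> bounded m x -> bounded m' x.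
Proof. by move=> le_mm' bx j /bx; lia. Qed.

Lemma bounded_tpow m (a : nat) x : bounded m x -> bounded (a + m) (tpow a *: x).
Proof. by move=> bx j; rewrite coefv_tpow => /bx; lia. Qed.

Lemma bounded_constv v : bounded 1 (constv v).
Proof.
by move=> j; rewrite coefv_constv; case: (j =P 0) => [-> //|_]; rewrite eqxx.
Qed.

Lemma bounded0 x : bounded 0 x -> x = 0.
Proof.
by move/boundedP=> bx; apply: coefv_inj => j; rewrite coefv0 bx //; lia.
Qed.

Lemma bounded_shift x : exists a m : nat, bounded m (tpow a *: x).
Proof.
have [d ->] := rV_laurentE x.
pose p := \sum_(j <- d) tpow j *: constv (coefv x j).
suff [a ba] : exists a : nat, forall j, coefv p j != 0 -> - a%:Z <= j < a%:Z.
  by exists a, (a + a)%N => j; rewrite coefv_tpow => /ba; lia.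
apply: (big_ind (fun y => exists a : nat,
  forall j, coefv y j != 0 -> - a%:Z <= j < a%:Z)).
- by exists 0%N => j; rewrite coefv0 eqxx.
- move=> y z [a ya] [c zc]; exists (maxn a c) => j; rewrite coefvD.
  have [->|/ya ? _] := eqVneq (coefv y j) 0; last by lia.
  by rewrite add0r => /zc; lia.
move=> i _; exists `|i|.+1%N => j; rewrite coefv_tpow => /bounded_constv; lia.
Qed.

(** The argument of Hilbert's basis theorem.  The leading coefficients of the
    elements of [S] of degree at most [k] form a subgroup of [Z^n], which grows
    with [k] since [S] is stable under [t]; let it stop growing at [K].  Then
    the leading term of an element of higher degree is cancelled by a shift of
    an element of degree at most [K], so the degree can be decreased. *)
Lemma lspan_bounded (S : 'rV[laurent]_n -> Prop) : submodule S ->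
  exists K, forall x, S x -> lspan (fun y => S y /\ bounded K.+1 y) x.
Proof.
move=> sS.
have SB x y : S x -> S y -> S (x - y).
  by move=> Sx Sy; rewrite addrC -scaleN1r; apply: sS.2.
(* The coefficient at [k] may vanish: [C k] has to be a subgroup. *)
pose C k v := exists x, [/\ S x, bounded k.+1 x & coefv x k%:Z = v].
have [k|k _ [x [Sx bx <-]]|K CK] := @noetherian_rV n C.
- split=> [|_ _ [x [Sx bx <-]] [y [Sy b_y <-]]].
    exists 0; split; [exact: sS.1 | exact: (bounded_zsubgroup _).1 |].
    exact: coefv0.
  exists (x - y); split; [exact: SB | exact: (bounded_zsubgroup _).2 |].
  exact: coefvB.
- exists (tpow 1 *: x); split; [exact: submoduleZ | |].
    exact: (@bounded_tpow _ 1).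
  by rewrite coefv_tpow; congr (coefv x _); lia.
exists K => x Sx; have [a [m bx]] := bounded_shift x.
have spG := lspan_submodule (fun y => S y /\ bounded K.+1 y).
(* Up to a power of [t], which is invertible, [x] is a polynomial. *)
rewrite -[x]scale1r -tpow0 -(addNr a%:Z) tpowD -scalerA.
apply: (submoduleZ _ spG).
have {Sx} : S (tpow a *: x) by apply: submoduleZ.
move: (tpow a *: x) bx => {a}x; elim: m => [|m IHm] in x * => bx Sx.
  by rewrite (bounded0 bx); apply: spG.1.
have [le_mK|lt_Km] := leqP m K.
  by apply: mem_lspan; split => //; exact: (boundedW _ bx).
have [|y [Sy b_y yE]] := CK m (coefv x m); first by exists x.
rewrite -(subrK (tpow (m - K)%N *: y) x) addrC; apply: spG.2.
  by apply: mem_lspan.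
apply: IHm; last by apply: SB => //; apply: submoduleZ.
have b_ty : bounded m.+1 (tpow (m - K)%N *: y).
  by apply: (boundedW _ (@bounded_tpow _ (m - K)%N _ b_y)); lia.
move=> j nz; have := (bounded_zsubgroup _).2 _ _ bx b_ty j nz.
suff : j != m by lia.
apply: contraNneq nz => ->; rewrite coefvB coefv_tpow.
by rewrite (_ : m%:Z - (m - K)%N%:Z = K) ?yE ?subrr //; lia.
Qed.

End Bounded.

(** * Splitting a finitely generated module *)

Lemma zsubgroup_gen (V : zmodType) (C : V -> Prop) x :
  zsubgroup C -> x \in gen_subgroup C -> C x.
Proof.
move=> [C0 CB] /gen_subgroupP/(_ (fun y => `[< C y >])) Cx; apply/asboolP.
apply: Cx => [|y Cy]; last exact/asboolP.
by split=> [|y z /asboolP Cy /asboolP Cz]; apply/asboolP => //; apply: CB.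
Qed.

(** The subgroup generated by [C] as a group of its own; passing through
    [gen_subgroup], whose closure under subtraction is known by inference,
    makes it one for every [C]. *)
Definition subgroup_type (V : zmodType) (C : V -> Prop) : Type :=
  {x : V | x \in gen_subgroup C}.

HB.instance Definition _ (V : zmodType) (C : V -> Prop) :=
  SubChoice.on (subgroup_type C).
HB.instance Definition _ (V : zmodType) (C : V -> Prop) :=
  [SubChoice_isSubZmodule of subgroup_type C by <:].

Section Extension.
Variables (U B : zmodType) (f g : {additive U -> B}).
Variables (M : lmodType laurent) (h : {additive B -> M}).

(** The unique [Z[t, t^-1]]-linear extension of [h] that sends [b_j] to
    [t^j h(b)]. *)
Definition zsum_ext (x : zsum B) : M := \sum_(j <- msupp x) tpow j *: h x@_j.

Lemma zsum_extw (d : {fset int}) x : msupp x `<=` d ->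
  zsum_ext x = \sum_(j <- d) tpow j *: h x@_j.
Proof.
move=> le_xd; rewrite /zsum_ext (big_fset_incl _ le_xd) //.
move=> j _ /mcoeff_outdom ->.
by rewrite raddf0 scaler0.
Qed.

Lemma zsum_extB x y : zsum_ext (x - y) = zsum_ext x - zsum_ext y.
Proof.
rewrite (zsum_extw (msuppB_le x y)).
rewrite (zsum_extw (fsubsetUl (msupp x) (msupp y))).
rewrite (zsum_extw (fsubsetUr (msupp x) (msupp y))) -sumrB.
by apply: eq_bigr => j _; rewrite mcoeffB raddfB scalerBr.
Qed.
HB.instance Definition _ :=
  GRing.isAdditive.Build (zsum B) M zsum_ext zsum_extB.

Lemma zsum_extZ (p : laurent) b : zsum_ext (p *: copy 0 b) = p *: h b.
Proof.
have le_p : msupp (p *: copy 0 b : zsum B) `<=` msupp p.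
  apply/fsubsetP => j; rewrite -!mcoeff_neq0; apply: contraNneq => pj.
  by rewrite [X in X == 0]coef_convU subr0 pj mulr0z.
rewrite (zsum_extw le_p) [p in RHS](laurentE (fsubset_refl _)) scaler_suml.
apply: eq_bigr => j _; rewrite [X in h X]coef_convU subr0 raddfMz.
by rewrite mulrC -scalerA scaler_int.
Qed.

Lemma zsum_ext_copy j b : zsum_ext (copy j b) = tpow j *: h b.
Proof.
by rewrite -zsum_extZ; congr zsum_ext; rewrite [RHS]convUU addr0 mulr1z.
Qed.

Lemma zsum_ext_amalgam x : (forall w, h (f w) = laurent_t *: h (g w)) ->
  x \in amalgam_sub f g -> zsum_ext x = 0.
Proof.
move=> hfg /gen_subgroupP/(_ [pred x | zsum_ext x == 0]) H; apply/eqP/H.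
  split=> [|y z]; rewrite !inE ?raddf0 // => /eqP y0 /eqP z0.
  by rewrite zsum_extB y0 z0 subrr.
move=> _ [w [j ->]]; rewrite inE zsum_extB !zsum_ext_copy hfg tpowD -scalerA.
by rewrite subrr.
Qed.

End Extension.

Section Splitting.
Variables (M : lmodType laurent) (n : nat) (e : 'I_n -> M) (K : nat).
Notation comb := (lincomb e).

(** The elements of [M] that are integral combinations of the [t^j e_i] with
    [0 <= j < m]. *)
Definition slab (m : nat) (y : M) : Prop := exists2 x, bounded m x & comb x = y.

Lemma slab_zsubgroup m : zsubgroup (slab m).
Proof.
have [b0 bB] := @bounded_zsubgroup n m.
split=> [|_ _ [x bx <-] [y b_y <-]]; first by exists 0; rewrite ?linear0.
by exists (x - y); rewrite ?linearB //; apply: bB.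
Qed.

Definition slab_group (m : nat) : zmodType := subgroup_type (slab m).

Definition mk_slab m y (sy : slab m y) : slab_group m :=
  exist _ y (mem_gen_subgroup sy).

Lemma val_slab m (u : slab_group m) : slab m (val u).
Proof. exact: zsubgroup_gen (slab_zsubgroup m) (valP u). Qed.

Lemma slabS m y : slab m y -> slab m.+1 y.
Proof. by move=> [x bx <-]; exists x => //; apply: boundedW bx. Qed.

Lemma slab_t m y : slab m y -> slab m.+1 (laurent_t *: y).
Proof.
move=> [x bx <-]; exists (tpow 1 *: x); last by rewrite linearZ.
by have := @bounded_tpow n m 1 x bx.
Qed.

Definition slab_incl (u : slab_group K) : slab_group K.+1 :=
  mk_slab (slabS (val_slab u)).
Definition slab_shift (u : slab_group K) : slab_group K.+1 :=
  mk_slab (slab_t (val_slab u)).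

Fact slab_incl_additive : additive slab_incl.
Proof. by move=> u v; apply: val_inj; rewrite [RHS]raddfB. Qed.
HB.instance Definition _ :=
  GRing.isAdditive.Build _ _ slab_incl slab_incl_additive.

Fact slab_shift_additive : additive slab_shift.
Proof. by move=> u v; apply: val_inj; rewrite [RHS]raddfB; apply: scalerBr. Qed.
HB.instance Definition _ :=
  GRing.isAdditive.Build _ _ slab_shift slab_shift_additive.

Lemma slab_incl_inj : injective slab_incl.
Proof. by move=> u v /(congr1 val) eq_uv; apply: val_inj. Qed.

Lemma scale_tpow_inj (V : lmodType laurent) j :
  injective (fun x : V => tpow j *: x).
Proof.
move=> x y /(congr1 (fun z => tpow (- j) *: z)).
by rewrite !scalerA -!tpowD addNr tpow0 !scale1r.
Qed.

Lemma slab_shift_inj : injective slab_shift.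
Proof. by move=> u v /(congr1 val) /scale_tpow_inj eq_uv; apply: val_inj. Qed.

Lemma bounded_expand m (x : 'rV[laurent]_n) : bounded m x ->
  x = \sum_(i < m) tpow i%:Z *: constv (coefv x i).
Proof.
move=> /boundedP bx; apply: coefv_inj => j.
rewrite (big_morph (fun z => coefv z j) (fun y z => coefvD y z j) (coefv0 n j)).
under eq_bigr => i _ do rewrite coefv_tpow coefv_constv subr_eq0.
have [/andP[j_ge0 j_lt]|/bx xj0] := boolP (0 <= j < m%:Z); last first.
  by rewrite xj0 big1 // => i _; case: (j =P i) => // <-; rewrite xj0.
case: j j_ge0 j_lt => // k _ lt_km.
rewrite (bigD1 (Ordinal lt_km)) //= eqxx mulr1n big1 ?addr0 // => i ne_ik.
by case: (k%:Z =P i) => // -[ki]; case/eqP: ne_ik; apply: val_inj.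
Qed.

Lemma slab_monomial m (i : 'I_m) (k : 'I_n) : slab m (tpow i%:Z *: e k).
Proof.
exists (tpow i%:Z *: constv (delta_mx 0 k)).
  apply: (boundedW _ (@bounded_tpow n 1 i _ (@bounded_constv n _))).
  by rewrite addn1.
rewrite linearZ /=; congr (_ *: _).
rewrite /lincomb (bigD1 k) //= !mxE !eqxx scale1r big1 ?addr0 // => j ne_jk.
by rewrite !mxE eqxx (negbTE ne_jk) scale0r.
Qed.

Lemma slab_fg m : fg_group (slab_group m).
Proof.
pose monom (p : 'I_m * 'I_n) := mk_slab (slab_monomial p.1 p.2).
exists #|{: 'I_m * 'I_n}|, (monom \o enum_val) => y.
have [x bx xy] := val_slab y.
pose c (p : 'I_m * 'I_n) := coefv x p.1%:Z 0 p.2; exists (c \o enum_val).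
apply: val_inj; rewrite raddf_sum -xy {1}(bounded_expand bx) linear_sum.
under [RHS]eq_bigr => p _ do rewrite raddfMz.
rewrite -(reindex (@enum_val _ _) (P := xpredT) (F := fun p : 'I_m * 'I_n =>
  (tpow p.1%:Z *: e p.2) *~ coefv x p.1%:Z 0 p.2)) /=; last first.
  by apply: onW_bij; apply: enum_val_bij.
rewrite -(pair_bigA _ (fun (i : 'I_m) (k : 'I_n) =>
  (tpow i%:Z *: e k) *~ coefv x i%:Z 0 k)) /=.
apply: eq_bigr => i _; rewrite linearZ /= /lincomb scaler_sumr.
by apply: eq_bigr => k _; rewrite [constv _ _ _]mxE scaler_int scalerMzr.
Qed.

Lemma slab_gen i : slab K.+1 (e i).
Proof.
by have := slab_monomial (ord0 : 'I_K.+1) i; rewrite tpow0 scale1r.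
Qed.

Notation amal := (amalgam slab_shift slab_incl).
Notation fac := (factor slab_shift slab_incl).
Definition slab_basis i : slab_group K.+1 := mk_slab (slab_gen i).
Definition to_amalgam : 'rV[laurent]_n -> amal :=
  lincomb (fun i => fac 0 (slab_basis i)).
HB.instance Definition _ := GRing.isLinear.Build laurent _ amal *:%R to_amalgam
  (lincomb_is_linear _).

Lemma val_zcomb_slab v : val (zcomb slab_basis v) = comb (constv v).
Proof.
rewrite raddf_sum; apply: eq_bigr => i _.
by rewrite raddfMz mxE scaler_int.
Qed.

Lemma to_amalgam_constv v : to_amalgam (constv v) = fac 0 (zcomb slab_basis v).
Proof.
rewrite /factor -copies_constv; exact/esym/pi_copies.
Qed.

Lemma factor0 j : fac j 0 = 0.
Proof. by rewrite /factor raddf0; apply: (linear0 (amalgam_pi _ _)). Qed.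

Lemma factorD j a b : fac j (a + b) = fac j a + fac j b.
Proof. by rewrite /factor [copy _ _]raddfD raddfD. Qed.

(** Within the degrees available in a single factor, the amalgam sees only the
    value in [M].  Horner's rule: the constant coefficient is in the factor
    already, and [t] times the remaining part, which lies in the slab that is
    amalgamated, is brought back into the same factor by the gluing relation. *)
Lemma to_amalgam_bounded m x (y : slab_group K.+1) :
  (m <= K.+1)%N -> bounded m x -> comb x = val y -> to_amalgam x = fac 0 y.
Proof.
elim: m => [|m IHm] in x y * => le_mK bx xy.
  move: xy; rewrite (bounded0 bx) !linear0 => y0.
  have -> : y = 0 by apply: val_inj; rewrite -y0 raddf0.
  exact/esym/factor0.
pose x' := tpow (-1) *: (x - constv (coefv x 0)).
have x'E : x = laurent_t *: x' + constv (coefv x 0).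
  by rewrite scalerA -tpowD subrr tpow0 scale1r subrK.
have bx' : bounded m x'.
  move=> j; rewrite coefv_tpow coefvB coefv_constv opprK.
  case: (j + 1 =P 0) => [->|ne_j]; first by rewrite mulr1n subrr eqxx.
  by rewrite mulr0n subr0 => /bx; lia.
have sx' : slab K (comb x') by exists x' => //; apply: (boundedW _ bx').
pose w : slab_group K := mk_slab sx'.
rewrite x'E linearD linearZ /= (IHm x' (slab_incl w)) ?(ltnW le_mK) //.
rewrite amalgam_t_glue to_amalgam_constv -factorD; congr (fac 0 _).
apply: val_inj; rewrite raddfD -xy [in RHS]x'E linearD linearZ.
by congr (_ + _); apply: val_zcomb_slab.
Qed.

Hypothesis genM : forall y, exists x, comb x = y.
Hypothesis kerM : forall x, comb x = 0 ->
  lspan (fun y => comb y = 0 /\ bounded K.+1 y) x.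

(** A relation of [M] holds in the amalgam because it is a combination of
    relations that fit in one factor, where [to_amalgam_bounded] applies.
    Conversely the inclusion of the factor in [M] extends to the amalgam. *)
Lemma ker_to_amalgam x : to_amalgam x = 0 <-> comb x = 0.
Proof.
split=> [|/kerM/(_ (fun y => to_amalgam y = 0))]; last first.
  apply; first split=> [|a y z y0 z0]; first exact: linear0.
    by apply: etrans (linearP _ _ _ _) _; rewrite /= y0 z0 scaler0 addr0.
  move=> y [y0 b_y].
  rewrite (to_amalgam_bounded (leqnn _) b_y (y := 0)) ?y0 ?raddf0 //.
  exact: factor0.
rewrite -[to_amalgam x]pi_copies -(linear0 (amalgam_pi slab_shift slab_incl)).
move=> /amalgam_piE; rewrite subr0 => /(zsum_ext_amalgam (h := val)) H.
rewrite -H // raddf_sum; apply: eq_bigr => i _.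
by rewrite [RHS]zsum_extZ.
Qed.

Lemma to_amalgam_surj z : exists x, to_amalgam x = z.
Proof.
rewrite -(amalgam_reprK z) [generic_quotient.repr z]zsumE.
move: (msupp _) => d; rewrite linear_sum.
apply: (big_ind (fun z => exists x, to_amalgam x = z)).
- by exists 0; apply: linear0.
- by move=> _ _ [x <-] [y <-]; exists (x + y); apply: linearD.
move=> j _; set b := _@_j; have [x bx xb] := val_slab b.
exists (tpow j *: x).
by rewrite !linearZ /= (to_amalgam_bounded (leqnn _) bx xb).
Qed.

(** Both [comb] and [to_amalgam] are surjections from the same free module, and
    they have the same kernel. *)
Lemma slab_amalgam_iso : lmod_iso M amal.
Proof.
have /choice[lift liftE] := genM.
have toE x y : comb x = comb y -> to_amalgam x = to_amalgam y.
  move=> eqxy; apply/eqP; rewrite -subr_eq0 -linearB; apply/eqP/ker_to_amalgam.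
  by rewrite linearB /= eqxy subrr.
pose phi y := to_amalgam (lift y).
have phi_lin : linear phi.
  by move=> a x y; rewrite /phi -linearP; apply: toE; rewrite linearP /= !liftE.
pose phiL := GRing.isLinear.Build laurent M amal *:%R phi phi_lin.
exists (HB.pack_for {linear M -> amal} phi phiL).
have /choice[sec secE] := to_amalgam_surj.
exists (fun z => comb (sec z)) => y /=.
  rewrite -[RHS]liftE; apply/eqP; rewrite -subr_eq0 -linearB.
  apply/eqP/ker_to_amalgam.
  by rewrite linearB /= secE subrr.
by rewrite /phi -[RHS]secE; apply: toE.
Qed.

End Splitting.

(** The two amalgamated groups are slabs of [M] tall enough for the relations
    between the generators to be generated by those that fit in [B]. *)
Lemma fg_module_splits (M : lmodType laurent) : fg_module M ->
  exists (U B : zmodType) (f g : {additive U -> B}), amalgam_decomp M f g.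
Proof.
move=> [n [e genM]].
have [|K kerM] := @lspan_bounded n (fun x => lincomb e x = 0).
  by split=> [|a x y x0 y0]; rewrite ?linear0 // linearP /= x0 y0 scaler0 addr0.
exists (slab_group e K), (slab_group e K.+1).
exists (@slab_shift _ _ e K), (@slab_incl _ _ e K).
split; [exact: slab_fg | exact: slab_fg | | |].
- exact: slab_shift_inj.
- exact: slab_incl_inj.
apply: slab_amalgam_iso => // y; have [c ->] := genM y.
by exists (\row_i c i); apply: eq_bigr => i _; rewrite mxE.
Qed.

Theorem proposition2p4 (M : lmodType laurent) (hM : fg_module M) :
  (exists (U B : zmodType) (f g : {additive U -> B}), amalgam_decomp M f g) /\
  (forall (U B : zmodType) (f g : {additive U -> B}),
     amalgam_decomp M f g ->
     forall q : nat, generated_by U q ->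
     forall Delta : laurent, is_order M Delta ->
     (ldeg Delta <= (q%:Z)%:E)%E).
Proof.
split=> [|U B f g [_ fgB _ _ isoM] q genU Delta]; first exact: fg_module_splits.
exact: (order_ldeg_le fgB genU isoM).
Qed.
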